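(* Let $r\ge 1$. Consider a single-input single-output controlled system in global normal form of relative degree $r$, $$\dot z=f_0(z,\mu,t),\qquad \dot\mu_i=\mu_{i+1}\ (i=1,\dots,r-1),\qquad \dot\mu_r=q(z,\mu,t)+b(z,\mu,t)u,\qquad y=\mu_1,$$ with state $(z,\mu)\in\mathbb{R}^{n_z}\times\mathbb{R}^r$ and control input $u\in\mathbb{R}$, and a reference system in global normal form of the same relative degree $r$, $$\dot z^\star=f_0^\star(z^\star,\mu^\star,t),\qquad \dot\mu_i^\star=\mu_{i+1}^\star\ (i=1,\dots,r-1),\qquad \dot\mu_r^\star=q^\star(z^\star,\mu^\star,t)+b^\star(z^\star,\mu^\star,t)v,\qquad y^\star=\mu^\star_1,$$ with state $(z^\star,\mu^\star)\in\mathbb{R}^{n_{z^\star}}\times\mathbb{R}^r$ and input $v\in\mathbb{R}$ (the dimensions $n_z$ and $n_{z^\star}$ need not coincide). Let $\mathcal{V}$ be a set of bounded functions $v:[0,\infty)\to\mathbb{R}$, and assume that $f_0^\star$, $q^\star$ and $b^\star$ are uniformly continuous in all their arguments. Consider the system with state $(\zeta,\xi)\in\mathbb{R}^{n_{z^\star}}\times\mathbb{R}^r$, driven by the output $y=\mu_1$ of the controlled system and by $v$, with output $\varepsilon$: $$\dot\zeta=f_0^\star(\zeta,\mu_1,\bar\xi,t),\qquad \dot\xi_i=\xi_{i+1}\ (i=1,\dots,r-1),\qquad \dot\xi_r=q^\star(\zeta,\mu_1,\bar\xi,t)+b^\star(\zeta,\mu_1,\bar\xi,t)v,\qquad \varepsilon=\mu_1-\xi_1,$$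 where $\bar\xi=(\xi_2,\dots,\xi_r)$. Then this system has the synchrony detection property for the reference system and for the class $\mathcal{V}$.
   Context: Notation: in $f_0^\star(\zeta,\mu_1,\bar\xi,t)$, and likewise in $q^\star$ and $b^\star$, the $\mu^\star$-argument is the vector $(\mu_1,\xi_2,\dots,\xi_r)\in\mathbb{R}^r$ (for $r=1$, $\bar\xi$ is empty). Since the systems have relative degree $r$, $b$ and $b^\star$ vanish nowhere. Solutions are differentiable functions on $[0,\infty)$ satisfying the differential equations. Asymptotic solution: for a system $\dot\chi=\gamma(\chi,w,t)$ with state $\chi$ and input $w$, a function $\chi_{\mathrm{as}}$ is an asymptotic solution corresponding to the input $w$ if it is differentiable and $\lim_{t\to\infty}|\dot\chi_{\mathrm{as}}(t)-\gamma(\chi_{\mathrm{as}}(t),w(t),t)|=0$. Synchrony detection property: consider a system $\dot\sigma=\phi(\sigma,y,v,t)$, $\varepsilon=\gamma(\sigma,y,v,t)$, driven by the output $y$ of a controlled system and by $v$. It has the synchrony detection property for a reference system $\dot x^\star=f^\star(x^\star,v,t)$, $y^\star=h^\star(x^\star,t)$, and for the class $\mathcal{V}$ if the following holds: for every $v\in\mathcal{V}$ and every output $y$ that can be generated by the controlled system (for some initial condition and some control input $u$), and for every corresponding solution $\sigma$, the condition $\lim_{t\to\infty}\varepsilon(t)=0$ implies that there exists an asymptotic solution $x^\star_{\mathrm{as}}$ of the reference system corresponding to $v$, with output $y^\star_{\mathrm{as}}(t)=h^\star(x^\star_{\mathrm{as}}(t),t)$, such that $\lim_{t\to\infty}|y(t)-y^\star_{\mathrm{as}}(t)|=0$.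 Here the reference system is the normal form given in the claim, with $x^\star=(z^\star,\mu^\star)$ and $h^\star(x^\star,t)=\mu^\star_1$. *)

(* Defs.v *)
From HB Require Import structures.
From mathcomp Require Import all_boot all_order all_algebra.
From mathcomp Require Import all_classical all_reals all_analysis.
Import Order.TTheory GRing.Theory Num.Theory.
Import numFieldNormedType.Exports.

Set Implicit Arguments.
Unset Strict Implicit.
Unset Printing Implicit Defensive.

Local Open Scope classical_set_scope.
Local Open Scope ring_scope.

(* The time set is [0, +oo), but signals, trajectories and vector fields take
   time in the whole of R, so that the library's limits apply to them.  Every
   condition below bears on nonnegative times only. *)
Definition time_set (R : realType) : set R := [set t | 0 <= t].
Arguments time_set R : clear implicits.

(* [d] is the derivative of [x] at [t] relative to [0, +oo): the two-sided
   derivative for t > 0 and the right derivative at t = 0. *)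
Definition has_derivative (R : realType) (X : normedModType R)
    (x : R -> X) (t : R) (d : X) : Prop :=
  (h^-1 *: (x (t + h) - x t))
    @[h --> within [set h | time_set R (t + h)] (0 : R)^'] --> d.

Definition is_solution (R : realType) (X : normedModType R) (W : Type)
    (F : X -> W -> R -> X) (w : R -> W) (x : R -> X) : Prop :=
  forall t, time_set R t -> has_derivative x t (F (x t) (w t) t).

Definition is_asymptotic_solution (R : realType) (X : normedModType R)
    (W : Type) (F : X -> W -> R -> X) (w : R -> W) (x : R -> X) : Prop :=
  exists2 dx : R -> X,
    forall t, time_set R t -> has_derivative x t (dx t) &
    `|dx t - F (x t) (w t) t| @[t --> +oo] --> (0 : R).

Definition is_output (R : realType) (X : normedModType R)
    (f : X -> R -> R -> X) (h : X -> R -> R) (y : R -> R) : Prop :=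
  exists (u : R -> R) (x : R -> X),
    is_solution f u x /\ forall t, time_set R t -> y t = h (x t) t.

(* [f], [h] is the controlled system, [phi], [gam] the detecting system (whose
   arguments are its state, y, v and time), [fs], [hs] the reference system. *)
Definition synchrony_detection (R : realType) (X S Xs : normedModType R)
    (f : X -> R -> R -> X) (h : X -> R -> R)
    (phi : S -> R -> R -> R -> S) (gam : S -> R -> R -> R -> R)
    (fs : Xs -> R -> R -> Xs) (hs : Xs -> R -> R)
    (V : set (R -> R)) : Prop :=
  forall v, V v -> forall y, is_output f h y ->
  forall s : R -> S,
    is_solution (fun s yv t => phi s yv.1 yv.2 t) (fun t => (y t, v t)) s ->
    gam (s t) (y t) (v t) t @[t --> +oo] --> (0 : R) ->
  exists2 xas : R -> Xs,
    is_asymptotic_solution fs v xas &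
    `|y t - hs (xas t) t| @[t --> +oo] --> (0 : R).

(* (mu_2, ..., mu_r, a) *)
Definition chain (R : realType) (r : nat) (mu : 'rV[R]_r) (a : R) : 'rV[R]_r :=
  \row_(i < r) oapp (fun j : 'I_r => mu ord0 j) a (insub i.+1).

(* (y, xi_2, ..., xi_r) *)
Definition set_first (R : realType) (r : nat) (y : R) (xi : 'rV[R]_r) :
    'rV[R]_r :=
  \row_(i < r) if i == 0%N :> nat then y else xi ord0 i.

Definition first_coord (R : realType) (r : nat) (r_gt0 : (0 < r)%N)
    (mu : 'rV[R]_r) : R :=
  mu ord0 (Ordinal r_gt0).

Section NormalForm.
Variables (R : realType) (n r : nat).
Variables (f0 : 'rV[R]_n -> 'rV[R]_r -> R -> 'rV[R]_n).
Variables (q b : 'rV[R]_n -> 'rV[R]_r -> R -> R).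

Definition normal_form (x : 'rV[R]_n * 'rV[R]_r) (u t : R) :
    'rV[R]_n * 'rV[R]_r :=
  (f0 x.1 x.2 t, chain x.2 (q x.1 x.2 t + b x.1 x.2 t * u)).

Definition normal_form_output (r_gt0 : (0 < r)%N) (x : 'rV[R]_n * 'rV[R]_r)
    (t : R) : R :=
  first_coord r_gt0 x.2.

Definition detector (s : 'rV[R]_n * 'rV[R]_r) (y v t : R) :
    'rV[R]_n * 'rV[R]_r :=
  let m := set_first y s.2 in
  (f0 s.1 m t, chain s.2 (q s.1 m t + b s.1 m t * v)).

Definition detector_output (r_gt0 : (0 < r)%N) (s : 'rV[R]_n * 'rV[R]_r)
    (y v t : R) : R :=
  y - first_coord r_gt0 s.2.

End NormalForm.

(* Joint uniform continuity in (z, mu, t), over times t >= 0; spaces carry the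
   library's sup norm, which is uniformly equivalent to the Euclidean one. *)
Definition unif_continuous_field (R : realType) (n r : nat)
    (E : uniformType) (g : 'rV[R]_n -> 'rV[R]_r -> R -> E) : Prop :=
  unif_continuous
    ((fun p => g p.1.1 p.1.2 p.2) :
      subspace [set p : 'rV[R]_n * 'rV[R]_r * R | time_set R p.2] -> E).

(* Main.v *)
(* Any solution (zeta, xi) of the detecting system is itself an asymptotic
   solution of the reference system: the two vector fields differ only in the
   first coordinate of the mu-argument, by y - xi_1 = epsilon -> 0, so by
   uniform continuity their difference tends to 0. *)
Require Import Defs.
From HB Require Import structures.
From mathcomp Require Import all_boot all_order all_algebra.
From mathcomp Require Import all_classical all_reals all_analysis.
Import Order.TTheory GRing.Theory Num.Theory.
Import numFieldNormedType.Exports.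

Local Open Scope classical_set_scope.
Local Open Scope ring_scope.

(** Entourages are unfolded into a modulus for the [mu]-argument alone. It is uniform in [z] and
    [t], which matters since trajectories may be unbounded. *)
Lemma unif_continuous_fieldP (R : realType) (n r : nat) (E : normedModType R)
    (g : 'rV[R]_n -> 'rV[R]_r -> R -> E) :
  unif_continuous_field g -> forall e : R, 0 < e ->
  exists2 d : R, 0 < d & forall z m m' t, 0 <= t -> `|m - m'| < d ->
    `|g z m t - g z m' t| < e.
Proof.
move=> guc e e0.
have /guc : entourage [set xy : E * E | ball xy.1 e xy.2].
  by rewrite -entourage_ballE; exists e.
rewrite /nbhs /= => -[A].
rewrite -entourage_ballE => -[d /= d0 dA] Ag; exists d => // z m m' t t0 mm'.
have : ball (g z m t) e (g z m' t).
  (* A subspace entourage consists of equal pairs or close pairs inside the subspace; [right] picks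
     the latter, both times being [t >= 0]. *)
  apply: (Ag ((z, m, t), (z, m', t))) => /=; right; split=> //; split=> //.
  apply: dA; split; last exact: ballxx.
  by split; [exact: ballxx | rewrite -ball_normE].
by rewrite -ball_normE.
Qed.

Lemma unif_continuous_field_cvg0 (R : realType) (n r : nat)
    (E : normedModType R) (g : 'rV[R]_n -> 'rV[R]_r -> R -> E)
    (z : R -> 'rV[R]_n) (m m' : R -> 'rV[R]_r) :
  unif_continuous_field g -> m t - m' t @[t --> +oo] --> (0 : 'rV[R]_r) ->
  g (z t) (m t) t - g (z t) (m' t) t @[t --> +oo] --> (0 : E).
Proof.
move=> /unif_continuous_fieldP guc mm'; apply/cvgr0Pnorm_lt => e e0.
have [d d0 dg] := guc e e0.
near=> t; apply: dg; first by near: t; exact: nbhs_pinfty_ge.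
by near: t; exact: cvgr0_norm_lt.
Unshelve. all: by end_near. Qed.

(** Turns the scalar convergence of the detector output into convergence of the [mu]-arguments. *)
Lemma set_first_sub (R : realType) (r : nat) (r_gt0 : (0 < r)%N) (y : R)
    (xi : 'rV[R]_r) :
  set_first y xi - xi = (y - first_coord r_gt0 xi) *: delta_mx ord0 (Ordinal r_gt0).
Proof.
apply/rowP => i; rewrite !mxE -[i == Ordinal _]val_eqE /=.
case: eqP => [i0|_]; last by rewrite subrr mulr0.
by rewrite mulr1; congr (y - xi _ _); apply/val_inj.
Qed.

(** All entries but the last are shifted entries of the same [mu] and cancel. *)
Lemma chain_sub (R : realType) (r : nat) (mu : 'rV[R]_r)
    (a a' : R) :
  `|chain mu a - chain mu a'| <= `|a - a'|.
Proof.
rewrite [leLHS]mx_normrE; apply: bigmax_le => // -[i j] _ /=.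
rewrite !mxE; case: insubP => [k _ _|_] /=; last by [].
by rewrite subrr normr0.
Qed.

Lemma bounded_mul_cvg0 (R : realType) (f v : R -> R) :
  [bounded v t | t in time_set R] -> f t @[t --> +oo] --> (0 : R) ->
  f t * v t @[t --> +oo] --> (0 : R).
Proof.
move=> /ex_strict_bound_gt0[M M0 vM] f0; apply/cvgr0Pnorm_lt => e e0.
near=> t; rewrite normrM -(divfK (lt0r_neq0 M0) e).
apply: ltr_pM => //; last first.
  by apply: vM; rewrite /time_set /=; near: t; exact: nbhs_pinfty_ge.
by near: t; apply: cvgr0_norm_lt => //; exact: divr_gt0.
Unshelve. all: by end_near. Qed.

Theorem theorem1 (R : realType) (r : nat) (r_gt0 : (0 < r)%N) (nz nzs : nat)
  (f0 : 'rV[R]_nz -> 'rV[R]_r -> R -> 'rV[R]_nz)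
  (q b : 'rV[R]_nz -> 'rV[R]_r -> R -> R)
  (b_neq0 : forall z mu t, time_set R t -> b z mu t != 0)
  (f0s : 'rV[R]_nzs -> 'rV[R]_r -> R -> 'rV[R]_nzs)
  (qs bs : 'rV[R]_nzs -> 'rV[R]_r -> R -> R)
  (bs_neq0 : forall z mu t, time_set R t -> bs z mu t != 0)
  (V : set (R -> R))
  (V_bounded : forall v, V v -> [bounded v t | t in time_set R])
  (f0s_uc : unif_continuous_field f0s)
  (qs_uc : unif_continuous_field qs)
  (bs_uc : unif_continuous_field bs) :
  synchrony_detection
    (normal_form f0 q b) (@normal_form_output R nz r r_gt0)
    (detector f0s qs bs) (@detector_output R nzs r r_gt0)
    (normal_form f0s qs bs) (@normal_form_output R nzs r r_gt0)
    V.
Proof.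
move=> v Vv y _ s s_sol eps0; exists s; last first.
  by rewrite -(@normr0 _ R); exact: cvg_norm eps0.
(* The derivative of [s] is the detector field, so the residual is the gap between the two fields
   along [s]. *)
exists (fun t => detector f0s qs bs (s t) (y t) (v t) t); first exact: s_sol.
pose m t := set_first (y t) (s t).2.
have m0 : m t - (s t).2 @[t --> +oo] --> (0 : 'rV[R]_r).
  under eq_fun do rewrite /m (set_first_sub _ _ r_gt0).
  rewrite -(scale0r (delta_mx ord0 (Ordinal r_gt0))).
  exact: cvgZ eps0 (cvg_cst _).
have F0 := unif_continuous_field_cvg0 _ _ _ _ _ (fun t => (s t).1) _ _ f0s_uc m0.
have Q0 := unif_continuous_field_cvg0 _ _ _ _ _ (fun t => (s t).1) _ _ qs_uc m0.
have B0 := unif_continuous_field_cvg0 _ _ _ _ _ (fun t => (s t).1) _ _ bs_uc m0.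
(* The gap in the last coordinate; boundedness of [v] keeps the [bs] part vanishing after
   multiplication by the input. *)
have H0 := cvgD Q0 (bounded_mul_cvg0 _ _ _ (V_bounded v Vv) B0).
rewrite addr0 in H0.
apply/norm_cvg0P/cvgr0Pnorm_lt => e e0; near=> t.
rewrite prod_normE /= gt_max; apply/andP; split.
  by near: t; exact: cvgr0_norm_lt.
apply: le_lt_trans (chain_sub _ _ _ _ _) _.
(* Regroups the last-coordinate gap into the [qs] difference plus the [bs] difference times [v], the
   form of [H0]. *)
rewrite opprD addrACA -mulrBl.
by near: t; exact: (cvgr0_norm_lt _ (H0 _) e e0).
Unshelve. all: by end_near. Qed.
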